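(* Let $\eta>0$ and let $r\ge 3$ be an integer. Then there exists $n_0\in\mathbb N$ such that the following holds. Suppose that $G$ is a digraph on $n\ge n_0$ vertices where $r$ divides $n$ and that for every $x\in V(G)$, $d^+(x)\ge (1-1/r+\eta)n$ or $d^-(x)\ge (1-1/r+\eta)n$. Then $G$ contains a perfect $T_r$-packing.
   Context: A digraph has no loops and at most one edge in each direction between any two vertices; $d^+(x)$ and $d^-(x)$ denote the out- and indegree of $x$. $T_r$ denotes the transitive tournament on $r$ vertices. A $T_r$-packing in $G$ is a collection of vertex-disjoint copies of $T_r$ in $G$ (subdigraphs, not necessarily induced); it is perfect if it covers all vertices of $G$. *)

(* Defs.v *)
From mathcomp Require Import all_boot.

Set Implicit Arguments.
Unset Strict Implicit.
Unset Printing Implicit Defensive.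

(* A digraph on the finite vertex set V is an irreflexive e : rel V, where
   e x y means that there is an edge directed from x to y.  Both e x y and
   e y x may hold. *)

Definition outdeg (V : finType) (e : rel V) (x : V) : nat := #|[set y | e x y]|.

Definition indeg (V : finType) (e : rel V) (x : V) : nat := #|[set y | e y x]|.

Definition trans_tournament (r : nat) : rel 'I_r := fun i j => i < j.

(* A subdigraph with vertices in V is a pair (vertex set, edge set). *)
Definition subdigraph (V : finType) : Type := ({set V} * {set V * V})%type.

(* K is a subdigraph of e (not necessarily induced) isomorphic to h. *)
Definition is_copy (W V : finType) (h : rel W) (e : rel V) (K : subdigraph V) :
    Prop :=
  (forall x y : V, (x, y) \in K.2 -> e x y) /\
  exists f : W -> V,
    [/\ injective f,
        K.1 = [set f w | w : W] &
        K.2 = [set (f p.1, f p.2) | p : W * W & h p.1 p.2]].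

Definition is_packing (W V : finType) (h : rel W) (e : rel V)
    (P : {set {set V} * {set V * V}}) : Prop :=
  (forall K, K \in P -> is_copy h e K) /\
  (forall K K', K \in P -> K' \in P -> K != K' -> [disjoint K.1 & K'.1]).

Definition is_perfect_packing (W V : finType) (h : rel W) (e : rel V)
    (P : {set {set V} * {set V * V}}) : Prop :=
  is_packing h e P /\ \bigcup_(K in P) K.1 = [set: V].

(* Main.v *)
(** Say that [x] dominates its outneighbours in [G] if its outdegree is large,
    and its inneighbours otherwise. A sequence in which earlier
    terms dominate later ones spans a transitive tournament of [G], so it is
    enough to tile a digraph of minimum outdegree at least (1 - 1/r + eta) n.

    Tiles are removed greedily. If every vertex of a set [S] misses at most
    |S|/r outneighbours in [S], then repeatedly taking the heaviest common
    outneighbour gives a tile of at least average weight, for any weights on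
    [S]. With exponential weights measuring how close each vertex is to missing
    |S|/r outneighbours, this keeps the degree condition valid until only a
    small linear number of vertices is left.

    The leftover is absorbed. Any [r] vertices [x_i] are absorbed by many
    families of [r] tiles ("rows") such that [x_i] dominates the [i]-th row and
    the heads of the rows form a tile. Multiplicative weights over all
    [r]-tuples select linearly many disjoint families among which every
    [r]-tuple finds linearly many absorbers. *)

Require Import Defs.
From mathcomp Require Import all_boot all_order all_algebra.
From mathcomp Require Import reals.
From mathcomp Require Import ring lra sequences exp zify.

Import Order.TTheory GRing.Theory Num.Theory.
Local Open Scope ring_scope.

Set Implicit Arguments.
Unset Strict Implicit.

(** * Heavy chains and counting of tuples *)

(* The chain is picked greedily by weight; [b] is the weight of its last term,
   and the term in [b] vanishes in the case of interest [#|S| = k.+1 * l]. *)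
Lemma heavy_chain (R : realFieldType) (V : finType) (h : rel V) (w : V -> R)
    (l : R) (k : nat) (S : {set V}) :
  0 < l ->
  (forall x, x \in S -> #|[set y in S | ~~ h x y]|%:R <= l) ->
  k.+1%:R * l <= #|S|%:R ->
  exists s b,
    [/\ size s = k.+1, pairwise h s, {subset s <= S},
        forall x, x \in s -> b <= w x &
        \sum_(x in S) w x
          <= l * \sum_(x <- s) w x + (#|S|%:R - k.+1%:R * l) * b].
Proof.
move=> l_gt0; elim: k S => [|k IHk] S nondeg cardS.
all: have /card_gt0P [z zS] : (0 < #|S|)%N
  by rewrite -(ltr_nat R); apply: lt_le_trans cardS; rewrite mulr_gt0 ?ltr0n.
all: have [x xS x_max] : exists2 x, x \in S & forall y, y \in S -> w y <= w x
  by case: (arg_maxP w zS) => x; exists x.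
- exists [:: x], (w x); split=> //.
  + by move=> y; rewrite inE => /eqP ->.
  + by move=> y; rewrite inE => /eqP ->.
  + rewrite big_seq1 mul1r -mulrDl addrC subrK.
    by rewrite mulr_natl -sumr_const ler_sum.
- set S' := [set y in S | h x y]; set B := [set y in S | ~~ h x y].
  have S'S : {subset S' <= S} by move=> y; rewrite inE => /andP [].
  have split_sum (f : V -> R) :
      \sum_(y in S) f y = \sum_(y in B) f y + \sum_(y in S') f y.
    rewrite (bigID (fun y => h x y)) /= addrC.
    by congr (_ + _); apply: eq_bigl => y; rewrite !inE.
  have cards : #|S|%:R = #|B|%:R + #|S'|%:R :> R.
    by rewrite -!sum1_card !natr_sum split_sum.
  have cardB := nondeg x xS; rewrite -/B in cardB.
  have [y yS'||s [b [size_s chain_s sS' b_min sum_S']]] := IHk S'.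
  + apply: le_trans (nondeg y (S'S y yS')); rewrite ler_nat.
    by apply/subset_leq_card/subsetP => u; rewrite !inE => /andP [/andP [-> _]].
  + by move: cardS; rewrite cards -(natr1 k.+1) mulrDl mul1r; lra.
  have b_wx : b <= w x.
    case: s size_s b_min sS' {chain_s sum_S'} => // y s _ b_min sS'.
    apply: le_trans (b_min y _) (x_max _ _); rewrite ?mem_head //.
    by apply/S'S/sS'/mem_head.
  exists (x :: s), b; split=> /=.
  + by rewrite size_s.
  + rewrite chain_s andbT; apply/allP => y /sS'.
    by rewrite inE => /andP [].
  + by move=> y; rewrite inE => /predU1P [-> // | /sS' /S'S].
  + by move=> y; rewrite inE => /predU1P [-> // | /b_min].
  + rewrite big_cons split_sum mulrDr cards -(natr1 k.+1) [(_ + 1) * l]mulrDl mul1r.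
    have : \sum_(y in B) w y <= #|B|%:R * w x.
      rewrite mulr_natl -sumr_const ler_sum // => y.
      by rewrite inE => /andP [/x_max].
    have : (l - #|B|%:R) * (w x - b) >= 0 by rewrite mulr_ge0 // subr_ge0.
    move: sum_S'; set A1 := \sum_(y <- s) _; set A2 := _%:R * l.
    move: (#|B|%:R : R) (#|S'|%:R : R) => c c'; nra.
Qed.

(** The entries are chosen one after another, each in at least [M] ways. [P] lives on sequences so
    that it can be tested on prefixes. *)
Lemma card_tuple_ge (T : finType) (P : pred (seq T)) (M k : nat) :
  P [::] ->
  (forall s, (size s < k)%N -> P s -> M <= #|[set z | P (rcons s z)]|)%N ->
  (M ^ k <= #|[set t : k.-tuple T | P t]|)%N.
Proof.
move=> P0 extend.
suff gen j p : P p -> (size p + j <= k)%N ->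
    (M ^ j <= #|[set t : j.-tuple T | P (p ++ t)]|)%N by exact: (gen k [::]).
elim: j p => [|j IHj] p Pp size_p.
  by rewrite expn0; apply/card_gt0P; exists [tuple]; rewrite inE cats0.
rewrite -sum1dep_card (partition_big (@thead j T) xpredT) //= expnS.
have size_p' : (size p < k)%N by rewrite (leq_trans _ size_p) // addnS ltnS leq_addr.
apply: leq_trans (leq_mul (extend p size_p' Pp) (leqnn _)) _.
rewrite -sum1dep_card big_distrl /= big_mkcond /=.
apply: leq_sum => z _; case: ifP => // Pz; rewrite mul1n.
apply: leq_trans (IHj (rcons p z) Pz _) _; first by rewrite size_rcons addSnnS.
rewrite sum1dep_card.
rewrite -(@card_imset _ _ (fun t : j.-tuple T => cons_tuple z t)); last first.
  by move=> t t' /(congr1 val) /= [] /val_inj.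
apply/subset_leq_card/subsetP => u /imsetP [t].
by rewrite !inE cat_rcons => Pt ->; rewrite theadE Pt /=.
Qed.

Lemma size_flatten_const (T : eqType) (c : nat) (F : seq (seq T)) :
  (forall s, s \in F -> size s = c) -> size (flatten F) = (c * size F)%N.
Proof.
elim: F => [|s F IHF] sF /=; first by rewrite muln0.
rewrite size_cat mulnS sF ?mem_head // IHF // => t tF.
by apply: sF; rewrite inE tF orbT.
Qed.

(** * Tiles and absorption *)

Definition tile (V : finType) (h : rel V) (r : nat) : pred (seq V) :=
  fun s => (size s == r) && pairwise h s.

(** Multiplicities in [perm_eq] express covering and, when [s] is duplicate-free, disjointness of
    the tiles as well. *)
Definition tileable (V : finType) (h : rel V) (r : nat) (s : seq V) : Prop :=
  exists2 F, all (tile h r) F & perm_eq (flatten F) s.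

Section Tiling.

Variables (V : finType) (h : rel V) (r : nat).

Lemma tileable_perm (s t : seq V) :
  perm_eq s t -> tileable h r s -> tileable h r t.
Proof. by move=> st [F tF Fs]; exists F; last exact: perm_trans st. Qed.

Lemma tileable_cat (s t : seq V) :
  tileable h r s -> tileable h r t -> tileable h r (s ++ t).
Proof.
move=> [F tF Fs] [G tG Gt]; exists (F ++ G); first by rewrite all_cat tF.
by rewrite flatten_cat perm_cat.
Qed.

Lemma tileable_flatten (F : seq (seq V)) :
  (forall s, s \in F -> tileable h r s) -> tileable h r (flatten F).
Proof.
elim: F => [|s F IHF] tF; first by exists [::].
apply: tileable_cat; first by apply: tF; rewrite mem_head.
by apply: IHF => t Ft; apply: tF; rewrite inE Ft orbT.
Qed.

Lemma tile_tileable (s : seq V) : tile h r s -> tileable h r s.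
Proof. by move=> ts; exists [:: s]; rewrite /= ?ts ?cats0. Qed.

Definition absorbs (W : seq V) (g : seq (seq V)) : bool :=
  all2 (fun x s => all (h x) s) W g.

Definition absorber (x0 : V) (g : seq (seq V)) : bool :=
  all (tile h r) g && tile h r (map (head x0) g).

(* The heads of the rows form a tile of their own, and each element of [W]
   takes the place of the head of its row. *)
Lemma absorbs_tileable (x0 : V) (W : seq V) (g : seq (seq V)) :
  (0 < r)%N -> absorber x0 g -> absorbs W g ->
  tileable h r (W ++ flatten g).
Proof.
move=> r_gt0 /andP [tg /tile_tileable th] Wg.
suff [s ts ps] : exists2 s, tileable h r s &
    perm_eq (map (head x0) g ++ s) (W ++ flatten g).
  exact: tileable_perm ps (tileable_cat th ts).
elim: g W tg Wg {th} => [|a g IHg] [|x W] //=; first by exists [::] => //; exists [::].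
move=> /andP [ta tg] /andP [xa Wg].
have [s ts ps] := IHg W tg Wg.
(* Rows are nonempty because [r] is positive, so [head] never returns the default [x0]. *)
case: a ta xa => [|y a]; first by rewrite /tile eq_sym; case: (r) r_gt0.
move=> /andP [/= size_a /andP [ya ca]] /andP [xy xa].
exists ((x :: a) ++ s) => /=.
  by apply: (@tileable_cat (x :: a)) ts; apply: tile_tileable; rewrite /tile /= size_a xa.
apply/permP => p; have /permP/(_ p) := ps.
by rewrite /= !count_cat /= !count_cat; lia.
Qed.

(** Absorb [s] in blocks of [r] vertices, each with a fresh absorber. Every use lowers the counts by
    at most one, in step with [k], and the absorbers left at the end are tiled by their own rows. *)
Lemma absorb_all (x0 : V) (k : nat) (F : seq (seq (seq V))) (s : seq V) :
  (0 < r)%N -> all (absorber x0) F ->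
  (forall W, size W = r -> k <= count (absorbs W) F)%N ->
  size s = (r * k)%N -> tileable h r (s ++ flatten (map flatten F)).
Proof.
move=> r_gt0; elim: k F s => [|k IHk] F s aF many size_s.
  have -> : s = [::] by apply/size0nil; rewrite size_s muln0.
  apply: tileable_flatten => t /mapP [g /(allP aF) /andP [tg _] ->].
  by apply: tileable_flatten => a /(allP tg) /tile_tileable.
have size_W : size (take r s) = r.
  by rewrite size_takel // size_s mulnS leq_addr.
have /hasP [g gF Wg] : has (absorbs (take r s)) F.
  by rewrite has_count (leq_trans _ (many _ size_W)).
have pF := perm_to_rem gF.
have aF' : all (absorber x0) (g :: rem g F) by rewrite -(perm_all _ pF).
case/andP: aF' => ag aF'.
have IH : tileable h r (drop r s ++ flatten (map flatten (rem g F))).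
  apply: IHk => // [W sW|]; last by rewrite size_drop size_s mulnS addKn.
  have := many W sW; rewrite (permP pF) /=; case: (absorbs W g) => /=; lia.
apply: tileable_perm (tileable_cat (absorbs_tileable r_gt0 ag Wg) IH).
apply/permP => p.
have /permP/(_ p) := perm_flatten (perm_map flatten pF).
have : count p s = (count p (take r s) + count p (drop r s))%N.
  by rewrite -count_cat cat_take_drop.
by rewrite /= !count_cat; lia.
Qed.

End Tiling.

(** * Counting absorbers *)

Section AbsorberCount.

Variables (V : finType) (h : rel V) (r d : nat) (x0 : V).
Hypothesis irr_h : irreflexive h.
Hypothesis nondeg : forall x, (#|[set y | ~~ h x y]| <= d)%N.

Lemma card_common_nbrs (c U : seq V) (M : nat) :
  (M + size c * d + size U <= #|V|)%N ->
  (M <= #|[set z | all (h^~ z) c && (z \notin U)]|)%N.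
Proof.
elim: c M => [|x c IHc] M /= card_V.
  have -> : #|[set z | z \notin U]| = #|[predC U]|.
    by rewrite cardsE; apply: eq_card => z; rewrite !inE.
  have cardU : (#|U| + #|[predC U]| = #|V|)%N by exact: cardC [in U].
  have size_U : (#|U| <= size U)%N by exact: card_size.
  rewrite -(leq_add2l #|U|) cardU; apply: leq_trans card_V.
  by rewrite mul0n addn0 addnC leq_add2l.
have /IHc : (M + d + size c * d + size U <= #|V|)%N.
  by rewrite -(addnA M) -mulSn.
set A := [set z | _]; set B := [set z | _] => A_ge.
have /subset_leq_card : A \subset B :|: [set z | ~~ h x z].
  by apply/subsetP => z; rewrite !inE; case: (h x z); rewrite ?orbT ?orbF.
move=> A_le; rewrite -(leq_add2r d); apply: leq_trans A_ge _.
apply: leq_trans A_le _; rewrite cardsU; apply: leq_trans (leq_subr _ _) _.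
by rewrite leq_add2l.
Qed.

(** The head of a row must be dominated by [x] and by the earlier heads [hs], every later entry by
    [x] and the earlier entries of its row. Either way at most [r] vertices constrain the choice. *)
Lemma card_rows (x : V) (hs U : seq V) (M : nat) :
  (size hs < r)%N -> (M + r * d + size U <= #|V|)%N ->
  (M ^ r <= #|[set t : r.-tuple V |
     [&& pairwise h (x :: t), all (h^~ (head x0 t)) hs
       & all [predC U] t]]|)%N.
Proof.
move=> size_hs card_V.
(* [take 1 s] makes the condition on the head vacuous for the empty prefix. *)
pose P s := [&& pairwise h (x :: s), all (fun y => all (h^~ y) hs) (take 1 s)
               & all [predC U] s].
have -> : [set t : r.-tuple V | [&& pairwise h (x :: t),
    all (h^~ (head x0 t)) hs & all [predC U] t]] = [set t : r.-tuple V | P t].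
  apply/setP => t; rewrite !inE /P; case: t => [[|y s] /= size_s].
    by move: size_hs; rewrite -(eqP size_s).
  by rewrite take0 /= andbT.
apply: card_tuple_ge => // s size_s /and3P [chain_s heads_s avoid_s].
pose c := x :: (if s is [::] then hs else s).
have size_c : (size c <= r)%N.
  by rewrite /c; case: (s) size_s => //= *; lia.
have /card_common_nbrs : (M + size c * d + size U <= #|V|)%N.
  by apply: leq_trans card_V; rewrite !leq_add2r leq_add2l leq_mul2r size_c orbT.
move/leq_trans; apply; apply/subset_leq_card/subsetP => z.
rewrite !inE => /andP [cz zU]; rewrite /P -rcons_cons pairwise_rcons chain_s.
rewrite all_rcons avoid_s /= zU !andbT.
move: cz heads_s; rewrite /c; case: (s) => [|y s'] /=.
  by rewrite !andbT => ->.
by rewrite !take0 => -> ->.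
Qed.

(** Rows are chosen one by one with [card_rows], the entries of earlier rows being added to the
    forbidden [U]; the term [r * r] pays for them. *)
Lemma card_absorbers (W : r.-tuple V) (U : seq V) (M : nat) :
  (M + r * d + (r * r + size U) <= #|V|)%N ->
  ((M ^ r) ^ r <= #|[set g : r.-tuple (r.-tuple V) |
     let g' := map val g in
     [&& absorber h r x0 g', absorbs h W g' & uniq (flatten g')]
       && all [predC U] (flatten g')]|)%N.
Proof.
move=> card_V.
pose P (g : seq (r.-tuple V)) := let g' := map val g in
  [&& pairwise h (map (head x0) g'), absorbs h (take (size g) W) g',
      all (pairwise h) g', uniq (flatten g') & all [predC U] (flatten g')].
have sizes (g : seq (r.-tuple V)) : size (flatten (map val g)) = (r * size g)%N.
  rewrite (@size_flatten_const _ r) ?size_map // => s /mapP [t _ ->].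
  exact: size_tuple.
apply: leq_trans (@card_tuple_ge _ P (M ^ r) r _ _) _; rewrite /P /=.
- by rewrite take0.
- move=> g size_g /and5P [heads_g abs_g chain_g uniq_g avoid_g].
  apply: leq_trans (@card_rows (nth x0 W (size g)) (map (head x0) (map val g))
    (flatten (map val g) ++ U) M _ _) _.
  + by rewrite !size_map.
  + apply: leq_trans card_V; rewrite leq_add2l size_cat leq_add2r sizes.
    by rewrite leq_mul2l ltnW ?orbT.
  apply/subset_leq_card/subsetP => t; rewrite !inE.
  move=> /and3P [/= /andP [xt chain_t] heads_t avoid_t].
  rewrite !map_rcons pairwise_rcons heads_t heads_g all_rcons chain_t chain_g.
  rewrite flatten_rcons cat_uniq uniq_g all_cat avoid_g size_rcons.
  rewrite (take_nth x0) ?size_tuple // /absorbs.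
  have -> : all2 (fun x s => all (h x) s)
      (rcons (take (size g) W) (nth x0 W (size g))) (rcons (map val g) t).
    move: abs_g; rewrite /absorbs !all2E !size_rcons eqSS.
    case/andP => sizes_eq; rewrite sizes_eq zip_rcons; last exact/eqP.
    by rewrite all_rcons /= xt => ->.
  rewrite (pairwise_uniq irr_h chain_t) !andbT /=.
  apply/andP; split.
    apply/hasPn => z /(allP avoid_t) /=.
    by rewrite mem_cat negb_or => /andP [].
  apply/allP => z /(allP avoid_t) /=.
  by rewrite mem_cat negb_or => /andP [].
apply/subset_leq_card/subsetP => g; rewrite !inE size_tuple.
rewrite take_oversize ?size_tuple // => /and5P [heads_g -> chain_g -> ->].
rewrite !andbT /absorber /tile heads_g !size_map size_tuple eqxx !andbT.
by apply/allP => s sg; rewrite (allP chain_g _ sg) andbT; case/mapP: sg => t _ ->;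
  rewrite size_tuple.
Qed.

End AbsorberCount.

(** * Selecting disjoint absorbers by multiplicative weights *)

(** Double counting: each [t] is related to a proportion at least [p] of [G], so an average [g]
    collects a share [p] of the weight. As the total is positive, such a [g] is related to some
    [t]. *)
Lemma exists_heavy_column (R : realFieldType) (T G : finType) (rel : T -> pred G)
    (w : T -> R) (p : R) (c : nat) (t0 : T) :
  0 < p -> (forall t, 0 < w t) -> p * #|G|%:R <= c%:R -> (0 < #|G|)%N ->
  (forall t, c <= #|[set g | rel t g]|)%N ->
  exists2 g, (exists t, rel t g) & p * \sum_t w t <= \sum_(t | rel t g) w t.
Proof.
move=> p_gt0 w_gt0 pG G_gt0 rel_ge.
have w_ge0 t : 0 <= w t by apply: ltW.
have sumw_gt0 : 0 < \sum_t w t.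
  by rewrite (bigD1 t0) //= ltr_pwDl ?sumr_ge0.
have [/existsP [g g_heavy] | /existsPn light] :=
  boolP [exists g, p * \sum_t w t <= \sum_(t | rel t g) w t].
  exists g => //; apply/existsP; apply: contraTT g_heavy => /existsPn norel.
  by rewrite [\sum_(t | rel t g) _]big_pred0 ?lt_geF ?mulr_gt0 // => t; apply/negbTE.
have /card_gt0P [g0 _] := G_gt0.
have : \sum_(g : G) \sum_(t | rel t g) w t < \sum_(g : G) p * \sum_t w t.
  apply: ltr_sum => [|g _]; last by rewrite ltNge light.
  by apply/hasP; exists g0; rewrite ?mem_index_enum.
rewrite ltNge => /negP []; rewrite sumr_const -mulr_natl mulrCA mulrA.
rewrite (exchange_big_dep xpredT) //= mulr_sumr ler_sum // => t _.
rewrite sumr_const -[leRHS]mulr_natl ler_wpM2r // (le_trans pG) // ler_nat.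
by rewrite (leq_trans (rel_ge t)) // cardsE.
Qed.

(* Multiplicative weights: the weight of [t] is divided by [e] whenever a new
   member of [F] is related to [t]. *)
Lemma multiplicative_weights (R : realType) (T G : finType) (abs : T -> pred G)
    (avail : pred (seq G)) (p : R) (m : nat) :
  avail [::] ->
  (forall F (w : T -> R), avail F -> (size F < m)%N -> (forall t, 0 < w t) ->
     exists2 g, avail (g :: F) & p * \sum_t w t <= \sum_(t | abs t g) w t) ->
  exists F, [/\ avail F, size F = m &
    \sum_t expR (- (count (abs t) F)%:R) <= expR (- (p / 2 * m%:R)) * #|T|%:R].
Proof.
move=> avail0; elim: m => [|m IHm] step.
  exists [::]; split=> //=.
  by rewrite mulr0 oppr0 expR0 mul1r sumr_const.
have [F w aF sF|F [aF sF wF]] := IHm; first by apply: step => //; apply: ltnW.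
pose w t : R := expR (- (count (abs t) F)%:R).
have w_gt0 t : 0 < w t by apply: expR_gt0.
have [|g agF g_heavy] := step F w aF _ w_gt0; first by rewrite sF.
exists (g :: F); split=> //=; first by rewrite sF.
(* Each weight hit by [g] at least halves, so the total shrinks by the factor [1 - p / 2], at most
   [expR (- (p / 2))]. *)
have e_half : expR (-1) <= 2^-1 :> R.
  rewrite expRN lef_pV2 ?posrE ?expR_gt0 ?ltr0n //.
  by have := expR_ge1Dx (1 : R); lra.
have : \sum_t expR (- (abs t g + count (abs t) F)%:R) <=
       \sum_t w t - 2^-1 * \sum_(t | abs t g) w t.
  rewrite [\sum_(t | abs t g) _]big_mkcond mulr_sumr -sumrB ler_sum // => t _.
  rewrite natrD opprD expRD -/(w t); case: (abs t g) => /=.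
    by move: e_half (w_gt0 t); set e := expR (-1) => *; nra.
  by rewrite oppr0 expR0 mul1r mulr0 subr0.
move/le_trans; apply.
apply: (@le_trans _ _ ((1 - p / 2) * \sum_t w t)); first by lra.
have -> : - (p / 2 * m.+1%:R) = - (p / 2) + - (p / 2 * m%:R).
  by rewrite -(natr1 m); ring.
rewrite expRD -mulrA.
apply: (@le_trans _ _ (expR (- (p / 2)) * \sum_t w t)).
  apply: ler_wpM2r; first by apply: sumr_ge0 => t _; apply: ltW.
  exact: expR_ge1Dx.
by rewrite ler_wpM2l // expR_ge0.
Qed.

(** Taking logarithms, every [W] gets at least [p / 2 * m] minus [r] times the logarithm of [#|V|]
    absorbers. The hypothesis on [M] leaves room to avoid all vertices used by earlier absorbers. *)
Lemma exists_absorbers (R : realType) (V : finType) (h : rel V) (r d : nat)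
    (x0 : V) (M m : nat) (p : R) :
  irreflexive h -> (forall x, #|[set y | ~~ h x y]| <= d)%N ->
  (M + r * d + (r * r + r * r * m) <= #|V|)%N ->
  0 < p -> p * (#|V| ^ (r * r))%:R <= (M ^ (r * r))%:R ->
  exists F : seq (seq (seq V)),
    [/\ all (absorber h r x0) F, size (flatten (map flatten F)) = (r * r * m)%N,
        uniq (flatten (map flatten F)) &
        forall W, size W = r ->
          expR (- (count (absorbs h W) F)%:R)
            <= expR (- (p / 2 * m%:R)) * (#|V| ^ r)%:R].
Proof.
move=> irr_h nondeg card_V p_gt0 pM.
pose rows (g : r.-tuple (r.-tuple V)) : seq (seq V) := map val g.
pose avail F := let F' := map rows F in
  all (absorber h r x0) F' && uniq (flatten (map flatten F')).
have size_rows g : size (flatten (rows g)) = (r * r)%N.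
  rewrite (@size_flatten_const _ r) ?size_map ?size_tuple // => s /mapP [t _ ->].
  exact: size_tuple.
have sizes F : size (flatten (map flatten (map rows F))) = (r * r * size F)%N.
  rewrite (@size_flatten_const _ (r * r)) ?size_map // => s /mapP [g' /mapP [g _ ->] ->].
  exact: size_rows.
have cardG : #|{: r.-tuple (r.-tuple V)}| = (#|V| ^ (r * r))%N.
  by rewrite !card_tuple expnM.
have [||F [/andP [aF uF] size_F wF]] := @multiplicative_weights R (r.-tuple V)
    (r.-tuple (r.-tuple V)) (fun W g => absorbs h W (rows g)) avail p m.
- by [].
- move=> F w /andP [aF uF] size_F w_gt0.
  pose U := flatten (map flatten (map rows F)).
  (* The relation includes conditions independent of [W]; one related [W] suffices to make [g] an
     absorber disjoint from [U]. *)
  have [|||||g [W /andP [/and3P [ag _ ug] Ug]] g_heavy] :=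
    @exists_heavy_column R (r.-tuple V) (r.-tuple (r.-tuple V))
    (fun W g => [&& absorber h r x0 (rows g), absorbs h W (rows g)
        & uniq (flatten (rows g))] && all [predC U] (flatten (rows g)))
    w p (M ^ (r * r)) (nseq_tuple r x0).
  + by [].
  + by [].
  + by rewrite cardG.
  + by rewrite cardG expn_gt0; apply/orP; left; apply/card_gt0P; exists x0.
  + move=> W; rewrite expnM; apply: card_absorbers => //.
    by apply: leq_trans card_V; rewrite !leq_add2l sizes leq_mul2l ltnW ?orbT.
  exists g.
    rewrite /avail /= ag aF cat_uniq ug uF /= andbT.
    by apply: (introT hasPn) => z zU; apply/negP => /(allP Ug) /=; rewrite zU.
  apply: le_trans g_heavy _; rewrite big_mkcond [leRHS]big_mkcond ler_sum // => W' _.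
  case: (absorbs _ _ _); rewrite /= ?andbF //; case: ifP => // _.
  by rewrite ltW.
exists (map rows F); split=> // [|W size_W]; first by rewrite sizes size_F.
have [W' ->] : exists W' : r.-tuple V, W = W'.
  by exists (Tuple (introT eqP size_W)).
rewrite -card_tuple; apply: le_trans wF.
rewrite (bigD1 W') //= count_map lerDl sumr_ge0 // => *; exact: expR_ge0.
Qed.

(** * Almost tiling by an exponential potential *)

(** Since [expR (- z) >= 1 - z], it suffices that the quadratic times [1 - z] is at least 1. *)
Lemma expR_le_quadratic (R : realType) (z : R) :
  `|z| <= 2^-1 -> expR z <= 1 + z + 2 * z ^+ 2.
Proof.
rewrite ler_norml => /andP [z_lo z_hi].
have := expRxMexpNx_1 z; have := expR_ge1Dx (- z); have := expR_gt0 z.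
move: (expR z) (expR (- z)) => a b a_gt0 b_ge ab.
have : a * (1 - z) <= 1 by rewrite -[leRHS]ab ler_wpM2l // ltW.
have : 1 <= (1 + z + 2 * z ^+ 2) * (1 - z).
  have -> : (1 + z + 2 * z ^+ 2) * (1 - z) = 1 + z ^+ 2 * (1 - 2 * z) by ring.
  by rewrite lerDl mulr_ge0 ?sqr_ge0 //; lra.
move=> /[swap] /le_trans /[apply]; rewrite ler_pM2r //; lra.
Qed.

Section AlmostTiling.

Variables (R : realType) (V : finType) (h : rel V) (r : nat) (tau delta : R).

Definition excess (S : {set V}) (v : V) : R :=
  #|[set u in S | ~~ h v u]|%:R - tau * #|S|%:R.

(** The sum runs over all of [V], so that its index set stays fixed while [S] shrinks. *)
Definition potential (S : {set V}) : R :=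
  \sum_v expR (delta * excess S v).

Hypotheses (irr_h : irreflexive h) (r_gt0 : (0 < r)%N) (tau_ge0 : 0 <= tau)
  (tau_r : tau * r%:R <= 1) (delta_gt0 : 0 < delta)
  (delta_r : delta * r%:R <= 2^-1).

(* One greedy step: a tile which is heavy for the weights
   [u |-> \sum_v expR (delta * excess S v) * ~~ h v u] removes from every [v]
   about its fair share of non-neighbours. *)
Lemma tile_removal (S : {set V}) :
  (0 < #|S|)%N ->
  (forall v, v \in S -> excess S v <= (1 / r%:R - tau) * #|S|%:R) ->
  exists s, [/\ tile h r s, {subset s <= S} &
    potential (S :\: [set x in s])
      <= (1 + 2 * (delta * r%:R) ^+ 2) * potential S
         + r%:R * #|V|%:R / #|S|%:R].
Proof.
move=> S_gt0 small_excess.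
have r0 : 0 < r%:R :> R by rewrite ltr0n.
have S0 : 0 < #|S|%:R :> R by rewrite ltr0n.
pose w v := expR (delta * excess S v).
have w_gt0 v : 0 < w v by apply: expR_gt0.
pose W u := \sum_v w v * (~~ h v u)%:R.
(* With [l] equal to [#|S| / r] and a chain of [r] terms, the coefficient of [b] vanishes. *)
have [|v vS||s [b [size_s chain_s sS _ sumW]]] :=
  @heavy_chain R V h W (#|S|%:R / r%:R) r.-1 S.
- by rewrite divr_gt0.
- have := small_excess v vS; rewrite /excess mulrBl mul1r lerD2r.
  by rewrite mulrC.
- by rewrite prednK // mulrC divfK // gt_eqF.
rewrite prednK // in size_s sumW.
have us := pairwise_uniq irr_h chain_s.
exists s; split=> //; first by rewrite /tile size_s eqxx.
pose c v : R := \sum_(u <- s) (~~ h v u)%:R.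
pose nn v : R := #|[set u in S | ~~ h v u]|%:R.
have nnE v : nn v = \sum_(u in S) (~~ h v u)%:R.
  rewrite /nn -sum1_card natr_sum big_mkcond [RHS]big_mkcond /=.
  by apply: eq_bigr => u _; rewrite inE; case: (u \in S); case: (h v u).
have c_ge0 v : 0 <= c v by apply: sumr_ge0 => u _; apply: ler0n.
have c_le v : c v <= r%:R.
  rewrite -size_s -sum1_size natr_sum ler_sum // => u _.
  by case: (h v u); rewrite ?ler01.
have cardD : #|S :\: [set x in s]|%:R = #|S|%:R - r%:R :> R.
  have /setIidPr sI : [set x in s] \subset S.
    by apply/subsetP => u; rewrite inE => /sS.
  have := cardsID [set x in s] S; rewrite sI cardsE (card_uniqP us) size_s.
  by move=> <-; rewrite natrD addrC addKr.
have nnD v : #|[set u in S :\: [set x in s] | ~~ h v u]|%:R = nn v - c v :> R.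
  have -> : [set u in S :\: [set x in s] | ~~ h v u]
      = [set u in S | ~~ h v u] :\: [set x in s].
    by apply/setP => u; rewrite !inE -andbA.
  have := cardsID [set x in s] [set u in S | ~~ h v u].
  have -> : [set u in S | ~~ h v u] :&: [set x in s]
      = [set u in filter (fun u => ~~ h v u) s].
    apply/setP => u; rewrite !inE mem_filter.
    by case u_s : (u \in s); [rewrite !andbT sS | rewrite !andbF].
  rewrite cardsE (card_uniqP _) ?filter_uniq // => nn_split.
  rewrite /nn -nn_split natrD size_filter -sum1_count natr_sum /c.
  rewrite (big_mkcond (fun u => ~~ h v u)) /= addrC.
  rewrite [X in _ + (X + _)](eq_bigr (fun u => (~~ h v u)%:R)) ?addKr // => u _.
  by case: (h v u).
have exD v : excess (S :\: [set x in s]) v = excess S v + (tau * r%:R - c v).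
  by rewrite /excess nnD cardD -/(nn v); ring.
have sum_wc : r%:R / #|S|%:R * (\sum_v w v * nn v) <= \sum_v w v * c v.
  have eW (T : seq V) P : \sum_(u <- T | P u) W u
      = \sum_v w v * \sum_(u <- T | P u) (~~ h v u)%:R.
    by rewrite exchange_big; apply: eq_bigr => v _; rewrite mulr_sumr.
  move: sumW; rewrite !eW (eq_bigr (fun v => w v * nn v)) => [|v _]; last by rewrite nnE.
  have -> : r%:R * (#|S|%:R / r%:R) = #|S|%:R :> R.
    by rewrite mulrC divfK // gt_eqF.
  rewrite subrr mul0r addr0 -/(c _) => le_sum.
  rewrite mulrAC ler_pdivrMr // mulrC -ler_pdivlMr // (le_trans le_sum) //.
  by rewrite le_eqVlt; apply/orP; left; apply/eqP; ring.
have step v : expR (delta * excess (S :\: [set x in s]) v)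
    <= w v * (1 + 2 * (delta * r%:R) ^+ 2) + delta * (w v * (tau * r%:R - c v)).
  rewrite exD mulrDr expRD -/(w v).
  set x := tau * r%:R - c v.
  have x_le : `|delta * x| <= delta * r%:R.
    rewrite normrM gtr0_norm // ler_pM2l // ler_norml.
    have r_ge1 : 1 <= r%:R :> R by rewrite ler1n.
    have tau_r_ge0 : 0 <= tau * r%:R by rewrite mulr_ge0 // ltW.
    rewrite /x lerBrDr lerBlDr; apply/andP; split.
      by rewrite (le_trans _ tau_r_ge0) // addrC subr_le0.
    by rewrite (le_trans tau_r) // (le_trans r_ge1) // lerDl.
  have := expR_le_quadratic (le_trans x_le delta_r).
  have : (delta * x) ^+ 2 <= (delta * r%:R) ^+ 2.
    by rewrite -[leLHS](real_normK (num_real _)) ler_sqr ?nnegrE // ltW // mulr_gt0.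
  move: (w_gt0 v); set q := (_ * r%:R) ^+ 2; set q' := _ ^+ 2; set e := expR _.
  by move=> *; nra.
(* Vertices of negative excess could make the drift positive, but each contributes at most
   [delta^-1], because [- y * expR y <= 1]. This is the source of the additive error. *)
have w_excess v : w v * - excess S v <= delta^-1.
  rewrite -[leRHS]mul1r ler_pdivlMr // -(expRxMexpNx_1 (delta * excess S v)).
  rewrite -mulrA ler_pM2l // (le_trans _ (expR_ge1Dx _)) //.
  by rewrite mulNr mulrC ler_wpDl.
have drift : \sum_v w v * (tau * r%:R - c v) <= r%:R / #|S|%:R * (#|V|%:R / delta).
  apply: (@le_trans _ _ (r%:R / #|S|%:R * \sum_v w v * - excess S v)); last first.
    rewrite ler_wpM2l ?divr_ge0 ?ler0n //.
    apply: le_trans (ler_sum _ (fun v _ => w_excess v)) _.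
    by rewrite sumr_const mulr_natl.
  have -> : \sum_v w v * - excess S v
      = tau * #|S|%:R * (\sum_v w v) - \sum_v w v * nn v.
    rewrite mulr_sumr -sumrB; apply: eq_bigr => v _.
    by rewrite /excess -/(nn v); ring.
  have -> : \sum_v w v * (tau * r%:R - c v)
      = tau * r%:R * (\sum_v w v) - \sum_v w v * c v.
    by rewrite mulr_sumr -sumrB; apply: eq_bigr => v _; ring.
  move: sum_wc; set A := \sum_v w v * nn v; set B := \sum_v w v * c v => AB.
  rewrite mulrBr [r%:R / _ * (_ * _)](_ : _ = tau * r%:R * \sum_v w v).
    by rewrite lerD2l lerN2.
  by field; rewrite gt_eqF.
rewrite /potential.
apply: le_trans (ler_sum _ (fun v _ => step v)) _.
rewrite big_split /= -mulr_suml -mulr_sumr mulrC lerD2l.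
apply: (@le_trans _ _ (delta * (r%:R / #|S|%:R * (#|V|%:R / delta)))).
  by rewrite ler_wpM2l // ltW.
rewrite le_eqVlt; apply/orP; left; apply/eqP; field.
by rewrite !gt_eqF.
Qed.

(** A vertex violating the degree condition would alone contribute more than the recurrence allows
    for the whole potential, so tiles can be removed until [r * K] vertices remain. *)
Lemma almost_tiling (S0 : {set V}) (K j : nat) :
  (0 < K)%N -> #|S0| = (r * (K + j))%N -> (forall v, excess S0 v <= 0) ->
  (1 + 2 * (delta * r%:R) ^+ 2) ^+ j * (#|V|%:R + j%:R * (#|V|%:R / K%:R))
    < expR (delta * ((1 / r%:R - tau) * (r * K)%:R)) ->
  exists F s, [/\ all (tile h r) F, perm_eq (flatten F ++ s) (enum S0)
    & size s = (r * K)%N].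
Proof.
move=> K_gt0 cardS0 excess0.
set q := 1 + _; set b := #|V|%:R / K%:R => small.
have q_ge1 : 1 <= q by rewrite lerDl mulr_ge0 ?sqr_ge0.
have q_ge0 : 0 <= q by apply: le_trans q_ge1.
have b_ge0 : 0 <= b by apply: divr_ge0.
have r0 : 0 < r%:R :> R by rewrite ltr0n.
suff gen i : (i <= j)%N -> exists (F : seq (seq V)) (S : {set V}),
    [/\ all (tile h r) F, perm_eq (flatten F ++ enum S) (enum S0),
        #|S| = (r * (K + (j - i)))%N &
        potential S <= q ^+ i * (#|V|%:R + i%:R * b)].
  have [F [S [tF FS cardS _]]] := gen j (leqnn j).
  by exists F, (enum S); rewrite -cardE cardS subnn addn0.
elim: i => [_|i IHi ij].
  exists [::], S0; split; rewrite ?subn0 //.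
  rewrite expr0 mul1r mul0r addr0 /potential -sum1_card natr_sum ler_sum // => v _.
  by rewrite -expR0 ler_expR mulr_ge0_le0 // ltW.
have [F [S [tF FS cardS potS]]] := IHi (ltnW ij).
have cardS_ge : (r * K <= #|S|)%N by rewrite cardS leq_mul2l leq_addr orbT.
have S_gt0 : (0 < #|S|)%N by rewrite (leq_trans _ cardS_ge) // muln_gt0 r_gt0.
have [v vS|s [ts sS potD]] := tile_removal S_gt0.
  rewrite leNgt; apply/negP => big_excess; move: small; apply/negP.
  rewrite -leNgt; apply: (@le_trans _ _ (expR (delta * excess S v))).
    rewrite ler_expR ler_pM2l // ltW // (le_lt_trans _ big_excess) //.
    by rewrite ler_wpM2l ?ler_nat // subr_ge0 ler_pdivlMr.
  apply: (@le_trans _ _ (potential S)).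
    by rewrite /potential (bigD1 v) //= lerDl sumr_ge0 // => *; apply: expR_ge0.
  apply: le_trans potS _; apply: ler_pM.
  - exact: exprn_ge0.
  - by apply: addr_ge0 => //; apply: mulr_ge0.
  - exact: (ler_weXn2l q_ge1 (ltnW ij)).
  - by rewrite lerD2l ler_wpM2r // ler_nat ltnW.
have us : uniq s by case/andP: ts => _ /(pairwise_uniq irr_h).
have pS : perm_eq (s ++ enum (S :\: [set x in s])) (enum S).
  apply: uniq_perm; rewrite ?enum_uniq //.
    rewrite cat_uniq us enum_uniq andbT /=.
    by apply/hasPn => x; rewrite mem_enum !inE => /andP [].
  move=> x; rewrite mem_cat !mem_enum !inE.
  by case xs : (x \in s); rewrite //= sS.
exists (s :: F), (S :\: [set x in s]); split.
- by rewrite /= ts.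
- apply: perm_trans FS; rewrite /= -catA perm_catCA perm_cat2l.
  exact: pS.
- have := perm_size pS; rewrite size_cat -!cardE cardS.
  case/andP: ts => /eqP -> _; rewrite !mulnDr; move/eqP.
  by rewrite -(subnSK ij) (mulnS r (j - i.+1)) addnCA eqn_add2l => /eqP.
- apply: le_trans potD _.
  have le_b : r%:R * #|V|%:R / #|S|%:R <= b.
    rewrite ler_pdivrMr ?ltr0n // /b mulrAC ler_pdivlMr ?ltr0n //.
    by rewrite -!natrM ler_nat mulnAC mulnC leq_mul2l cardS_ge orbT.
  (* The new error [b] is inflated to [q ^+ i.+1 * b] to give a closed form. *)
  apply: (@le_trans _ _ (q * (q ^+ i * (#|V|%:R + i%:R * b)) + q ^+ i.+1 * b)).
    apply: lerD; first by rewrite ler_wpM2l.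
    by apply: le_trans le_b _; rewrite ler_peMl // exprn_ege1.
  rewrite -(natr1 i) exprS le_eqVlt; apply/orP; left; apply/eqP; ring.
Qed.

End AlmostTiling.

(** * Growth estimates *)

Lemma exists_nat_gt (R : realType) (x : R) : exists n : nat, x < n%:R.
Proof.
exists (Num.bound `|x|).
exact: le_lt_trans (ler_norm x) (archi_boundP (normr_ge0 x)).
Qed.

(** Splitting the exponent into [k.+1] equal parts bounds the exponential below by
    [(b * n) ^+ k.+1], which has a factor [n] to spare. *)
Lemma expR_gt_poly (R : realType) (c A : R) (k : nat) :
  0 < c -> exists n1, forall n, (n1 <= n)%N -> A * n%:R ^+ k < expR (c * n%:R).
Proof.
move=> c_gt0; pose b := c / k.+1%:R.
have b_gt0 : 0 < b by rewrite divr_gt0.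
have [n1 n1_gt] := exists_nat_gt (A / b ^+ k.+1).
exists n1.+1 => n n_gt.
have n_gt0 : 0 < n%:R :> R by rewrite ltr0n (leq_trans _ n_gt).
have -> : c * n%:R = k.+1%:R * (b * n%:R) by rewrite /b mulrA mulrCA divff ?mulr1 ?pnatr_eq0.
rewrite expRM_natl; apply: (@lt_le_trans _ _ ((b * n%:R) ^+ k.+1)); last first.
  have bn_ge0 : 0 <= b * n%:R by rewrite mulr_ge0 // ltW.
  rewrite lerXn2r ?nnegrE ?expR_ge0 //.
  by apply: le_trans (expR_ge1Dx _); rewrite lerDr.
have -> : (b * n%:R) ^+ k.+1 = b ^+ k.+1 * n%:R * n%:R ^+ k.
  by rewrite exprMn (exprS n%:R) mulrA.
rewrite ltr_pM2r ?exprn_gt0 // -ltr_pdivrMl ?exprn_gt0 // mulrC.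
by apply: lt_le_trans n1_gt _; rewrite ler_nat ltnW.
Qed.

(** * From tiles to a packing of transitive tournaments *)

Section Packing.

Variables (V : finType) (e : rel V) (out : pred V) (r : nat) (x0 : V).

Definition chosen_edge : rel V := fun x y => if out x then e x y else e y x.

(** The head dominates the whole tail: its chosen edges all leave it or all enter it, so it goes
    first or last. *)
Fixpoint transitive_order (s : seq V) : seq V :=
  if s is x :: s' then
    if out x then x :: transitive_order s' else rcons (transitive_order s') x
  else [::].

Lemma perm_transitive_order (s : seq V) : perm_eq (transitive_order s) s.
Proof.
elim: s => //= x s IHs; case: ifP => _; first by rewrite perm_cons.
by rewrite perm_rcons perm_cons.
Qed.

Lemma pairwise_transitive_order (s : seq V) :
  pairwise chosen_edge s -> pairwise e (transitive_order s).
Proof.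
elim: s => //= x s IHs /andP [/allP xs /IHs es].
have xs' y : y \in transitive_order s -> chosen_edge x y.
  by rewrite (perm_mem (perm_transitive_order s)) => /xs.
case: ifP => ox /=; rewrite ?pairwise_rcons es andbT; apply/allP => y /xs';
  by rewrite /chosen_edge ox.
Qed.

Definition copy_on (s : seq V) : {set V} * {set V * V} :=
  let f (i : 'I_r) := nth x0 (transitive_order s) i in
  ([set f i | i : 'I_r],
   [set (f p.1, f p.2) | p : 'I_r * 'I_r & trans_tournament p.1 p.2]).

Lemma copy_on_vertices (s : seq V) :
  size s = r -> (copy_on s).1 = [set x in s].
Proof.
move=> size_s; have size_t := perm_size (perm_transitive_order s).
apply/setP => x; rewrite inE -(perm_mem (perm_transitive_order s)).
apply/imsetP/idP => [[i _ ->]|]; first by rewrite mem_nth // size_t size_s.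
move/(nthP x0) => [i i_lt <-]; rewrite size_t size_s in i_lt.
by exists (Ordinal i_lt).
Qed.

Lemma copy_on_is_copy (s : seq V) :
  irreflexive e -> tile chosen_edge r s ->
  is_copy (@trans_tournament r) e (copy_on s).
Proof.
move=> irr_e /andP [/eqP size_s /pairwise_transitive_order es].
have size_t : size (transitive_order s) = r.
  by rewrite (perm_size (perm_transitive_order s)).
split=> [x y /imsetP [[i j]]|]; last first.
  exists (fun i : 'I_r => nth x0 (transitive_order s) i); split=> // i j /eqP.
  by rewrite nth_uniq ?size_t // ?(pairwise_uniq irr_e es) // => /eqP /val_inj.
rewrite inE /= /trans_tournament => ij [-> ->].
by apply: (pairwiseP x0 es) => //; rewrite inE size_t.
Qed.

Lemma tileable_perfect_packing :
  irreflexive e -> tileable chosen_edge r (enum V) ->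
  exists P, is_perfect_packing (@trans_tournament r) e P.
Proof.
move=> irr_e [F /allP tF FV]; exists [set K in map copy_on F].
have verts s : s \in F -> (copy_on s).1 = [set x in s].
  by move=> /tF /andP [/eqP /copy_on_vertices].
split; [split=> [K|K K']|].
- by rewrite inE => /mapP [s /tF ts ->]; apply: copy_on_is_copy.
- rewrite !inE => /mapP [s sF ->] /mapP [s' s'F ->] neq.
  have {}neq : s' != s by apply: contraNneq neq => ->.
  rewrite !verts // -setI_eq0; apply/eqP/setP => x; rewrite !inE.
  have : uniq (flatten F) by rewrite (perm_uniq FV) enum_uniq.
  rewrite (perm_uniq (perm_flatten (perm_to_rem sF))) /= cat_uniq.
  case/and3P => _ /hasPn disj _; apply/negP => /andP [xs xs'].
  have /disj : x \in flatten (rem s F); last by rewrite /= xs.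
  apply/flattenP; exists s' => //.
  by have := perm_mem (perm_to_rem sF) s'; rewrite s'F inE (negPf neq).
apply/setP => x; rewrite inE; apply/bigcupP.
have /flattenP [s sF xs] : x \in flatten F by rewrite (perm_mem FV) mem_enum.
by exists (copy_on s); rewrite ?inE ?map_f // verts // inE.
Qed.

End Packing.

(** * Tiling under a minimum outdegree condition *)

Lemma outdegree_tileable (R : realType) (eta : R) (r : nat) :
  0 < eta -> eta < 1 / r%:R -> (3 <= r)%N ->
  exists n0 : nat, forall (V : finType) (h : rel V),
    irreflexive h -> (n0 <= #|V|)%N -> (r %| #|V|)%N ->
    (forall x, #|[set y | ~~ h x y]|%:R <= (1 / r%:R - eta) * #|V|%:R) ->
    tileable h r (enum V).
Proof.
move=> eta_gt0 eta_r r_ge3; have r_gt0 : (0 < r)%N by apply: leq_trans r_ge3.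
have rho_ge3 : 3 <= r%:R :> R by rewrite ler_nat.
have rho_gt0 : 0 < r%:R :> R by rewrite ltr0n.
(* Each of the [r * r] entries of an absorber will have at least [eta * n] choices. [L] makes
   [p / 2 * m] at least [2 * K], and [N] keeps all absorbers within [eta / 4 * n] vertices. *)
pose p := eta ^+ (r * r); have p_gt0 : 0 < p by rewrite exprn_gt0.
have [L L_gt] := exists_nat_gt (4 / p).
have L_gt0 : 0 < L%:R :> R by apply: lt_trans L_gt; rewrite divr_gt0.
have [N N_gt] := exists_nat_gt (r%:R * r%:R * L%:R * 4 / eta).
have N_gt0 : 0 < N%:R :> R by apply: lt_trans N_gt; rewrite divr_gt0 ?mulr_gt0.
(* Half of [eta] covers the loss of the absorbers, half is the tolerated excess. [delta] gives
   [2 * (delta * r) ^+ 2 = delta * kappa], and [kappa] makes the threshold exponent at least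
   [2 * delta * kappa * n]. *)
pose tau := 1 / r%:R - eta / 2.
pose kappa := eta * r%:R / (8 * N%:R).
pose delta := kappa / (2 * (r%:R * r%:R)).
have kappa_gt0 : 0 < kappa by rewrite divr_gt0 ?mulr_gt0.
have delta_gt0 : 0 < delta by apply: (divr_gt0 kappa_gt0); rewrite !mulr_gt0.
have [n1 n1P] := expR_gt_poly (1 + 2 * N%:R) 1 (mulr_gt0 delta_gt0 kappa_gt0).
have [n2 n2P] := @expR_gt_poly R (2 * N%:R)^-1 1 r ltac:(by rewrite invr_gt0 mulr_gt0).
have [n3 n3_gt] := exists_nat_gt (r%:R * r%:R / eta).
exists (n1 + n2 + n3 + N).+1 => V h irr_h card_V r_dvd nondeg.
set n := #|V| in card_V r_dvd nondeg.
have [n1_le n2_le n3_le N_le n_nat] : [/\ n1 <= n, n2 <= n, n3 <= n, N <= n & 0 < n]%N.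
  by split; apply: leq_trans card_V; clear; lia.
have {}n1P : (1 + 2 * N%:R) * n%:R < expR (delta * kappa * n%:R).
  by rewrite -[X in _ * X]expr1; exact: n1P.
have {}n2P : n%:R ^+ r < expR ((2 * N%:R)^-1 * n%:R) :> R.
  by rewrite -[X in X < _]mul1r; exact: n2P.
have n3P : r%:R * r%:R <= eta * n%:R.
  by rewrite [leRHS]mulrC -ler_pdivrMr // (le_trans (ltW n3_gt)) ?ler_nat.
have n_gt0 : 0 < n%:R :> R by rewrite ltr0n.
have [x0 _] : exists x0 : V, x0 \in V by apply/card_gt0P.
have N_nat : (0 < N)%N by rewrite -(ltr_nat R).
(* There will be [m] disjoint absorbers, at least [K] of them for each [r]-tuple,
   and the greedy phase stops when exactly [r * K] vertices are left. *)
pose K := (n %/ N)%N; pose m := (L * K)%N.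
have K_gt0 : (0 < K)%N by rewrite divn_gt0.
have K0 : 0 < K%:R :> R by rewrite ltr0n.
have NK_le : N%:R * K%:R <= n%:R :> R by rewrite -natrM ler_nat mulnC leq_divM.
have NK_ge : n%:R <= 2 * N%:R * K%:R :> R.
  rewrite -!natrM ler_nat; have := ltn_ceil n N_nat; rewrite -/K => n_lt.
  by move: n_lt K_gt0; move: (n) (K) => n' K'; clear; nia.
have A_le : r%:R * r%:R * m%:R <= eta / 4 * n%:R.
  rewrite natrM; apply: (@le_trans _ _ (eta / 4 * (N%:R * K%:R))).
    rewrite !mulrA ler_pM2r //.
    by move: N_gt; rewrite ltr_pdivrMr // => N_gt; lra.
  by rewrite ler_pM2l // divr_gt0.
have rK_le : r%:R * K%:R <= eta / 4 * n%:R.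
  apply: le_trans A_le; rewrite -!natrM ler_nat /m.
  have : (0 < L)%N by rewrite -(ltr_nat R).
  by move=> L_nat; rewrite -!mulnA leq_pmul2l // !mulnA leq_pmull // muln_gt0 r_gt0.
have eta_r_lt1 : eta * r%:R < 1 by move: eta_r; rewrite ltr_pdivlMr.
have tau_r : tau * r%:R = 1 - eta * r%:R / 2 by rewrite /tau; field; lra.
pose d := \max_x #|[set y | ~~ h x y]|.
have d_le : d%:R <= (1 / r%:R - eta) * n%:R.
  by rewrite /d; have [x ->] := @bigop.eq_bigmax V (fun x => #|[set y | ~~ h x y]|)
    n_nat.
have d_ge x : (#|[set y | ~~ h x y]| <= d)%N.
  exact: (@bigop.leq_bigmax V (fun x => #|[set y | ~~ h x y]|) x).
have rd_le : r%:R * d%:R <= n%:R - eta * r%:R * n%:R.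
  apply: (@le_trans _ _ (r%:R * ((1 / r%:R - eta) * n%:R))); first by rewrite ler_pM2l.
  by rewrite le_eqVlt; apply/orP; left; apply/eqP; field; lra.
pose M := (n - (r * d + (r * r + r * r * m)))%N.
have eta_n : 0 < eta * n%:R by rewrite mulr_gt0.
have eta_r_n : 3 * (eta * n%:R) <= eta * r%:R * n%:R.
  by rewrite [leRHS]mulrAC mulrC ler_wpM2l // ltW.
have Am_le : (r * r * m)%:R <= eta / 4 * n%:R by rewrite 2!natrM.
(* As [r >= 3], the term [r * d] leaves [3 * eta * n]; [r * r] costs at most [eta * n] and the
   absorbers [eta / 4 * n]. *)
have used_real : (r * d + (r * r + r * r * m))%:R <= n%:R - eta * n%:R.
  rewrite natrD (natrD _ (r * r)%N) (natrM _ r d) (natrM _ r r).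
  by lra.
have used_le : (r * d + (r * r + r * r * m) <= n)%N.
  by rewrite -(ler_nat R) (le_trans used_real) // gerBl ltW.
have M_ge : eta * n%:R <= M%:R.
  by rewrite natrB // lerBrDr addrC -lerBrDr.
have [|||F [aF size_A uA many]] :=
  @exists_absorbers R V h r d x0 M m p irr_h d_ge.
- by rewrite -/n /M -addnA subnK.
- by [].
- rewrite -/n !natrX -exprMn lerXn2r ?nnegrE //; exact: ltW.
pose A := flatten (map flatten F); rewrite -/A in size_A uA.
(* Fewer than [K] absorbers would give [W] a weight above [expR (- K)], while the bound is
   [expR (- 2 * K) * n ^+ r] and [n ^+ r < expR K]. *)
have absorb W : size W = r -> (K <= count (absorbs h W) F)%N.
  move/many; apply: contraTT; rewrite -!ltnNge -ltNge => few.
  apply: (@lt_le_trans _ _ (expR (- K%:R))); last first.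
    by rewrite ler_expR lerN2 ler_nat ltnW.
  have : - (p / 2 * m%:R) <= - K%:R - K%:R.
    rewrite -opprD lerN2 natrM mulrA -mulr2n -[leLHS]mulr_natl ler_pM2r //.
    by move: L_gt; rewrite ltr_pdivrMr // => L_gt; lra.
  rewrite -ler_expR -/n natrX => le_e.
  apply: (@le_lt_trans _ _ (expR (- K%:R - K%:R) * n%:R ^+ r)).
    by rewrite ler_wpM2r // exprn_ge0 // ltW.
  rewrite expRD -mulrA gtr_pMr ?expR_gt0 // expRN mulrC ltr_pdivrMr ?expR_gt0 //.
  rewrite mul1r (lt_le_trans n2P) // ler_expR mulrC ler_pdivrMr ?mulr_gt0 //.
  by rewrite mulrC.
pose S0 := ~: [set x in A].
have cardS0 : (#|S0| + r * r * m)%N = n.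
  have := cardsC [set x in A]; rewrite cardsE (card_uniqP uA) size_A addnC.
  by [].
have [j cardS0_j] : exists j, #|S0| = (r * (K + j))%N.
  have /dvdnP [q nq] := r_dvd.
  exists (q - r * m - K)%N.
  have : (r * r * m + r * K <= n)%N.
    rewrite -(ler_nat R) natrD (natrM _ r K).
    by nra.
  rewrite -mulnA -mulnDr nq (mulnC q) leq_pmul2l // => le_q.
  apply/eqP; rewrite -(eqn_add2r (r * r * m)) cardS0 nq -mulnA -mulnDr mulnC eqn_pmul2l //.
  by move: le_q; move: (r * m)%N (K) => a b; clear; lia.
have S0_real : #|S0|%:R = n%:R - r%:R * r%:R * m%:R :> R.
  by rewrite -[in RHS]cardS0 natrD !natrM addrK.
have tau_ge0 : 0 <= tau.
  by rewrite -(pmulr_lge0 _ rho_gt0) tau_r; lra.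
have tau_r_le : tau * r%:R <= 1.
  by rewrite tau_r gerBl divr_ge0 // mulr_ge0 // ltW.
have [||||||Ft [s1 [tFt Fs1 size_s1]]] :=
  @almost_tiling R V h r tau delta irr_h r_gt0 tau_ge0 _ delta_gt0 _ S0 K j.
- exact: tau_r_le.
- have -> : delta * r%:R = eta / (16 * N%:R).
    by rewrite /delta /kappa; field; rewrite !gt_eqF.
  have N_ge1 : 1 <= N%:R :> R by rewrite ler1n.
  rewrite ler_pdivrMr ?mulr_gt0 //.
  move: eta_r_lt1 rho_ge3 N_ge1 eta_gt0.
  by move: (r%:R : R) (N%:R : R) => x y; clear; nra.
- by [].
- by [].
- move=> v; rewrite /excess S0_real subr_le0.
  have nn_le : #|[set u in S0 | ~~ h v u]|%:R <= d%:R :> R.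
    rewrite ler_nat (leq_trans _ (d_ge v)) //; apply/subset_leq_card/subsetP => u.
    by rewrite !inE => /andP [].
  apply: le_trans nn_le (le_trans d_le _).
  have tau_le1 : tau <= 1.
    by apply: le_trans tau_r_le; rewrite ler_peMr // ler1n.
  have tau_u : tau * (r%:R * r%:R * m%:R) <= eta / 4 * n%:R.
    by apply: le_trans A_le; rewrite ler_piMl ?mulr_ge0.
  by rewrite mulrBr {1}/tau mulrBl (mulrBl _ _ (eta / 2)); lra.
- have -> : 2 * (delta * r%:R) ^+ 2 = delta * kappa.
    by rewrite /delta; field; rewrite gt_eqF.
  have j_le : j%:R <= n%:R :> R.
    rewrite ler_nat -cardS0 cardS0_j (leq_trans _ (leq_addr _ _)) //.
    by rewrite (leq_trans (leq_addl K j)) // leq_pmull.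
  have dk_gt0 : 0 < delta * kappa by apply: mulr_gt0.
  have pow_le : (1 + delta * kappa) ^+ j <= expR (delta * kappa * n%:R).
    apply: (@le_trans _ _ (expR (delta * kappa) ^+ j)).
      by rewrite lerXn2r ?nnegrE ?expR_ge0 ?expR_ge1Dx // addr_ge0 // ltW.
    by rewrite -expRM_natr ler_expR ler_wpM2l // ltW.
  have sum_le : n%:R + j%:R * (n%:R / K%:R) <= (1 + 2 * N%:R) * n%:R :> R.
    have -> : (1 + 2 * N%:R) * n%:R = n%:R + n%:R * (2 * N%:R) :> R by ring.
    rewrite lerD2l.
    by apply: ler_pM => //; rewrite ?divr_ge0 // ler_pdivrMr.
  rewrite -/n; apply: (@le_lt_trans _ _
    (expR (delta * kappa * n%:R) * ((1 + 2 * N%:R) * n%:R))).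
    apply: ler_pM => //; first by rewrite exprn_ge0 // addr_ge0 // ltW.
    by rewrite addr_ge0 // mulr_ge0 // divr_ge0.
  (* One half of the threshold exponent pays for the power [j], the other for the linear factor. *)
  apply: (@lt_le_trans _ _
    (expR (delta * kappa * n%:R) * expR (delta * kappa * n%:R))).
    by rewrite ltr_pM2l ?expR_gt0.
  rewrite -expRD ler_expR -mulrDr -mulrA ler_pM2l // natrM.
  have -> : 1 / r%:R - tau = eta / 2 by rewrite /tau; ring.
  have -> : kappa * (n%:R + n%:R) = eta / 2 * (r%:R * (n%:R / (2 * N%:R))).
    by rewrite /kappa; field; rewrite gt_eqF.
  by rewrite !ler_pM2l ?divr_gt0 // ler_pdivrMr ?mulr_gt0 // mulrC.
have := absorb_all r_gt0 aF absorb size_s1.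
rewrite -/A => ts1A.
have tFt' := tileable_flatten (fun s sF => tile_tileable (allP tFt s sF)).
apply: tileable_perm (tileable_cat tFt' ts1A).
rewrite catA (perm_trans (y := enum S0 ++ A)) //; first by rewrite perm_cat2r.
apply: uniq_perm; rewrite ?enum_uniq //.
  rewrite cat_uniq enum_uniq uA andbT /=.
  by apply/hasPn => x xA; rewrite mem_enum !inE xA.
by move=> x; rewrite mem_cat !mem_enum !inE; case: (x \in A).
Qed.

(** * Reduction to outdegrees *)

Unset Implicit Arguments.

Theorem theorem1p6 (R : realType) (eta : R) (r : nat) (heta : 0 < eta)
    (hr : (3 <= r)%N) :
  exists n0 : nat,
    forall (V : finType) (e : rel V),
      irreflexive e ->
      (n0 <= #|V|)%N ->
      (r %| #|V|)%N ->
      (forall x : V,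
         (1 - 1 / r%:R + eta) * #|V|%:R <= (outdeg e x)%:R \/
         (1 - 1 / r%:R + eta) * #|V|%:R <= (indeg e x)%:R) ->
      exists P : {set {set V} * {set V * V}},
        is_perfect_packing (@trans_tournament r) e P.
Proof.
pose out (V : finType) (e : rel V) : pred V :=
  fun x => (1 - 1 / r%:R + eta) * #|V|%:R <= (outdeg e x)%:R.
have nondeg (V : finType) (e : rel V) : (forall x : V,
      (1 - 1 / r%:R + eta) * #|V|%:R <= (outdeg e x)%:R \/
      (1 - 1 / r%:R + eta) * #|V|%:R <= (indeg e x)%:R) ->
    forall x, #|[set y | ~~ chosen_edge e (out V e) x y]|%:R
      <= (1 / r%:R - eta) * #|V|%:R.
  move=> deg x; set B := [set y | _].
  have card_B : #|~: B|%:R + #|B|%:R = #|V|%:R :> R.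
    by rewrite -natrD addnC cardsC.
  have -> : #|B|%:R = #|V|%:R - #|~: B|%:R :> R by rewrite -card_B addrC addKr.
  suff : (1 - 1 / r%:R + eta) * #|V|%:R <= #|~: B|%:R by lra.
  have [ox|ox] := boolP (out V e x).
    rewrite (_ : ~: B = [set y | e x y]) //.
    by apply/setP => y; rewrite !inE negbK /chosen_edge ox.
  rewrite (_ : ~: B = [set y | e y x]).
    by case: (deg x) => // ox'; move: ox; rewrite /out ox'.
  by apply/setP => y; rewrite !inE negbK /chosen_edge (negPf ox).
have irr_chosen (V : finType) (e : rel V) :
    irreflexive e -> irreflexive (chosen_edge e (out V e)).
  by move=> irr_e x; rewrite /chosen_edge irr_e if_same.
(* For [eta >= 1 / r] the degree condition is impossible, as each vertex is a non-neighbour of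
   itself. *)
have [eta_r|eta_r] := ltP eta (1 / r%:R); last first.
  exists 1%N => V e irr_e /card_gt0P [x _] _ deg; have deg_x := nondeg V e deg x.
  have le0 : (1 / r%:R - eta) * #|V|%:R <= 0.
    by apply: mulr_le0_ge0; rewrite ?subr_le0.
  suff : 0 < (1 / r%:R - eta) * #|V|%:R by rewrite ltNge le0.
  apply: lt_le_trans deg_x; rewrite ltr0n; apply/card_gt0P; exists x.
  by rewrite inE irr_chosen.
have [n0 n0P] := outdegree_tileable heta eta_r hr.
exists n0.+1 => V e irr_e card_V r_dvd deg.
have /card_gt0P [x0 _] : (0 < #|V|)%N by apply: leq_trans card_V.
apply: (@tileable_perfect_packing V e (out V e) r x0 irr_e).
by apply: n0P => //; [exact: irr_chosen | exact: ltnW | exact: (nondeg V e deg)].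
Qed.
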